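(* Let $G=(V,E)$ be a connected graph and let $\chi=(\mathfrak m,\mathfrak M)$ be a monitor placement for $G$, with $\hat m=|\mathfrak m|$ and $\hat M=|\mathfrak M|$. Then, under the $\mathrm{CSP}$ routing mechanism, $\mu(G\mid\chi)<\max(\hat m,\hat M)$.
   Context: A monitor placement $\chi=(\mathfrak m,\mathfrak M)$ for a graph $G=(V,E)$ specifies a set $\mathfrak m\subseteq V$ of input nodes (nodes linked to external input monitors) and a set $\mathfrak M\subseteq V$ of output nodes (nodes linked to external output monitors). Under the routing mechanism $\mathrm{CSP}$ (controllable simple-path probing), the set of measurement paths $\mathbb P(G\mid\chi)$ consists of all simple (cycle-free, no repeated node) paths in $G$ from a node of $\mathfrak m$ to a different node of $\mathfrak M$ (in directed graphs paths follow edge directions); in particular single-node paths are not allowed. For a node $v$, $\mathbb P(v)$ is the set of paths in $\mathbb P(G\mid\chi)$ passing through $v$, and for $U\subseteq V$, $\mathbb P(U)=\bigcup_{u\in U}\mathbb P(u)$. $V$ is $k$-identifiable if for all $U,W\subseteq V$ with $U\neq W$ and $|U|,|W|\le k$ we have $\mathbb P(U)\neq\mathbb P(W)$ (i.e. $\mathbb P(U)\triangle\mathbb P(W)\neq\emptyset$). The maximal identifiability $\mu(G\mid\chi)$ is the largest $k\ge 0$ such that $V$ is $k$-identifiable with respect to $\mathbb P(G\mid\chi)$. *)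

(* Defs.v *)
From mathcomp Require Import all_boot.

Set Implicit Arguments.
Unset Strict Implicit.
Unset Printing Implicit Defensive.

(* A finite graph is a relation [e : rel V] on a finite type:
   [e] is arbitrary for a directed graph and symmetric for an undirected one.
   Loops need not be excluded, since no simple path uses them. *)

(* Connectedness ignores edge directions: it is the usual connectedness when
   [e] is symmetric and weak connectedness in general. *)
Definition connected_graph (V : finType) (e : rel V) : Prop :=
  forall x y : V, connect [rel u v | e u v || e v u] x y.

(* A node may be both an input and an output.  Nonemptiness is not built in. *)
Record monitor_placement (V : finType) := MonitorPlacement {
  inputs : {set V};
  outputs : {set V}
}.

Section Identifiability.

Variables (V : finType) (e : rel V) (chi : monitor_placement V).

(* A path is the sequence of its nodes, in order. *)
Definition csp_path (p : seq V) : bool :=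
  if p is x :: s then
    [&& path e x s, uniq (x :: s), x \in inputs chi,
        last x s \in outputs chi & x != last x s]
  else false.

(* The carrier [#|V|.-bseq V] of sequences of length at most [#|V|] loses no
   path, since the nodes of a simple path are distinct (see [csp_path_size]);
   it makes sets of paths finite, with decidable equality. *)
Definition measurement_paths : {set #|V|.-bseq V} :=
  [set p : #|V|.-bseq V | csp_path p].

Definition paths_through (v : V) : {set #|V|.-bseq V} :=
  [set p in measurement_paths | v \in (p : seq V)].

Definition paths_touching (U : {set V}) : {set #|V|.-bseq V} :=
  \bigcup_(u in U) paths_through u.

Definition identifiable (k : nat) : bool :=
  [forall U : {set V}, forall W : {set V},
     [&& U != W, #|U| <= k & #|W| <= k] ==>
       (paths_touching U != paths_touching W)].

(* For k >= #|V| the cardinality bounds are void, so k-identifiability is the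
   same as #|V|-identifiability, and it is enough to let k range over
   0, ..., #|V|.  If all k were identifiable, no largest one would exist and
   this definition would return #|V|; [max_identifiabilityP] shows that in all
   other cases it is the largest identifiable k. *)
Definition max_identifiability : nat :=
  \max_(k < #|V|.+1 | identifiable k) k.

Lemma csp_path_size (p : seq V) : csp_path p -> size p <= #|V|.
Proof.
by case: p => // x s /and5P[_ us _ _ _]; rewrite -(card_uniqP us) max_card.
Qed.

Lemma identifiableW (j k : nat) : j <= k -> identifiable k -> identifiable j.
Proof.
move=> jk /forallP h; apply/forallP=> U; apply/forallP=> W; apply/implyP.
case/and3P=> UW Uj Wj; move/forallP/(_ W)/implyP: (h U); apply.
by rewrite UW (leq_trans Uj jk) (leq_trans Wj jk).
Qed.

Lemma identifiable0 : identifiable 0.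
Proof.
apply/forallP=> U; apply/forallP=> W; apply/implyP.
by rewrite !leqn0 !cards_eq0 => /and3P[UW /eqP U0 /eqP W0]; rewrite U0 W0 eqxx in UW.
Qed.

Lemma max_identifiabilityP (k : nat) :
  ~~ identifiable #|V| -> identifiable k = (k <= max_identifiability).
Proof.
move=> nV; apply/idP/idP=> [ik | ].
  have kV : k < #|V|.+1.
    by rewrite ltnS leqNgt; apply: contra nV => /ltnW/identifiableW; apply.
  exact: (leq_bigmax_cond (Ordinal kV) ik).
move/identifiableW; apply; rewrite /max_identifiability.
by elim/big_ind: _ => [|x y ix iy|//]; [exact: identifiable0 | rewrite /maxn; case: ifP].
Qed.

End Identifiability.

(* Main.v *)
(* Every measurement path meets the inputs and meets the outputs, so if these two
   sets differ they are not separated. If they coincide, a path has two distinct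
   endpoints in that set, hence it still meets the set with one node removed. *)

Require Import Defs.
From mathcomp Require Import all_boot.

Set Implicit Arguments.
Unset Strict Implicit.
Unset Printing Implicit Defensive.

Lemma csp_path_ends (V : finType) (e : rel V) (chi : monitor_placement V)
    (p : seq V) :
  csp_path e chi p ->
  exists x y, [/\ x \in inputs chi, y \in outputs chi, x != y, x \in p & y \in p].
Proof.
case: p => // x s /and5P[_ _ xI yO xy].
by exists x, (last x s); rewrite mem_head mem_last.
Qed.

(** Any two node sets that every measurement path meets are thus indistinguishable, as both touch
    all of [measurement_paths]. *)
Lemma paths_touchingT (V : finType) (e : rel V) (chi : monitor_placement V)
    (U : {set V}) :
  (forall p : seq V, csp_path e chi p -> exists2 u, u \in U & u \in p) ->
  paths_touching e chi U = measurement_paths e chi.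
Proof.
move=> hitU; apply/setP=> p; apply/bigcupP/idP => [[u _]|pP].
  by rewrite inE => /andP[].
have [|u uU up] := hitU p; first by rewrite inE in pP.
by exists u => //; rewrite inE pP.
Qed.

Lemma not_identifiable (V : finType) (e : rel V) (chi : monitor_placement V)
    (k : nat) (U W : {set V}) :
  U != W -> #|U| <= k -> #|W| <= k ->
  paths_touching e chi U = paths_touching e chi W -> ~~ identifiable e chi k.
Proof.
move=> UW Uk Wk eqUW; apply/negP=> /forallP/(_ U)/forallP/(_ W)/implyP.
by rewrite UW Uk Wk eqUW eqxx => /(_ isT).
Qed.

Lemma not_identifiable_maxn (V : finType) (e : rel V)
    (chi : monitor_placement V) :
  inputs chi :|: outputs chi != set0 ->
  ~~ identifiable e chi (maxn #|inputs chi| #|outputs chi|).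
Proof.
move=> chi0.
have hitI : paths_touching e chi (inputs chi) = measurement_paths e chi.
  by apply: paths_touchingT => p /csp_path_ends[x [y [xI _ _ xp _]]]; exists x.
have hitO : paths_touching e chi (outputs chi) = measurement_paths e chi.
  by apply: paths_touchingT => p /csp_path_ends[x [y [_ yO _ _ yp]]]; exists y.
have [IO|neqIO] := eqVneq (inputs chi) (outputs chi); last first.
  by apply: not_identifiable neqIO _ _ _; rewrite ?leq_maxl ?leq_maxr ?hitI.
(* Nonemptiness supplies the node [z] to remove. With no monitors at all the bound would be 0, and
   0-identifiability always holds. *)
move: chi0; rewrite -IO setUid maxnn => /set0Pn[z zI].
apply: (@not_identifiable _ _ _ _ (inputs chi) (inputs chi :\ z)) => //.
- by apply: contraTneq zI => ->; rewrite setD11.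
- by rewrite subset_leq_card ?subD1set.
rewrite hitI paths_touchingT // => p /csp_path_ends[x [y [xI yO xy xp yp]]].
(* At most one endpoint is [z]: if it is the start [x], the end [y] survives the removal and is an
   input by [IO]. *)
have [xz|xz] := eqVneq x z; last by exists x; rewrite // in_setD1 xz.
by exists y; rewrite // in_setD1 IO yO -xz eq_sym xy.
Qed.

Theorem theorem1 (V : finType) (e : rel V) (chi : monitor_placement V)
    (e_connected : connected_graph e)
    (chi_nonempty : inputs chi :|: outputs chi != set0) :
  max_identifiability e chi < maxn #|inputs chi| #|outputs chi|.
Proof.
have nid := not_identifiable_maxn e chi_nonempty.
rewrite ltnNge -max_identifiabilityP //.
(* What remains is that [#|V|]-identifiability fails, so [max_identifiability] is a true maximum and
   not its default value. Monotonicity gives this, as both monitor sets have at most [#|V|]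
   nodes. *)
by apply: contra nid; apply: identifiableW; rewrite geq_max !max_card.
Qed.
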